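(* Let $n\ge 3$, let $\mathrm{D}_{2n}=\langle a,b\mid a^n=b^2=(ab)^2=e\rangle$ be the dihedral group of order $2n$, and let $H$ be a proper subgroup of $\mathrm{D}_{2n}$. (a) $H$ is a perfect code of $\mathrm{D}_{2n}$ if and only if either $H\not\le\langle a\rangle$, or $H\le\langle a\rangle$ and at least one of $|H|$ and $n/|H|$ is odd. (b) $H$ is a total perfect code of $\mathrm{D}_{2n}$ if and only if either $H\not\le\langle a\rangle$, or $H\le\langle a\rangle$ with $|H|$ even and $n/|H|$ odd.
   Context: All groups and graphs are finite; $e$ denotes the identity. For a group $G$ and $S\subseteq G$ with $e\notin S$ and $S^{-1}=S$, the Cayley graph $\mathrm{Cay}(G,S)$ has vertex set $G$, with $x,y$ adjacent iff $yx^{-1}\in S$. A subset $C$ of the vertex set of a graph is a perfect code if every vertex is at distance at most one from exactly one vertex of $C$; it is a total perfect code if every vertex has exactly one neighbour in $C$. A subset $C\subseteq G$ is called a perfect code (resp. total perfect code) of $G$ if it is a perfect code (resp. total perfect code) in some Cayley graph $\mathrm{Cay}(G,S)$ of $G$. *)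

(* Defs.v *)
From mathcomp Require Import all_boot all_fingroup.
Set Implicit Arguments.
Unset Strict Implicit.
Unset Printing Implicit Defensive.

Local Open Scope group_scope.

Section Graphs.
Variables (T : finType) (e : rel T).

Definition dist_le (k : nat) (x y : T) : Prop :=
  exists p : seq T, [/\ path e x p, last x p = y & size p <= k].

Definition perfect_code_in (C : {set T}) : Prop :=
  forall v : T, exists! c : T, c \in C /\ dist_le 1 v c.

Definition total_perfect_code_in (C : {set T}) : Prop :=
  forall v : T, exists! c : T, c \in C /\ e v c.

Lemma dist_le1 x y : dist_le 1 x y <-> x = y \/ e x y.
Proof.
split=> [[[|z [|z' p]]] [] //= | [<- | exy]].
- by move=> _ ->; left.
- by rewrite andbT => exz <-; right.
- by exists [::].
- by exists [:: y]; rewrite /= exy.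
Qed.

End Graphs.

Section CayleyGraphs.
Variable gT : finGroupType.

Definition connection_set (S : {set gT}) : Prop := 1 \notin S /\ S^-1 = S.

Definition Cay (S : {set gT}) : rel gT := [rel x y | y * x^-1 \in S].

Lemma Cay_irrefl S : connection_set S -> irreflexive (Cay S).
Proof. by case=> S1 _ x; rewrite /Cay /= mulgV; apply/negbTE. Qed.

Lemma Cay_sym S : connection_set S -> symmetric (Cay S).
Proof. by case=> _ SV x y; rewrite /Cay /= -{1}SV inE invMg invgK. Qed.

Definition perfect_code (C : {set gT}) : Prop :=
  exists2 S : {set gT}, connection_set S & perfect_code_in (Cay S) C.

Definition total_perfect_code (C : {set gT}) : Prop :=
  exists2 S : {set gT}, connection_set S & total_perfect_code_in (Cay S) C.

End CayleyGraphs.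

(* Main.v *)
(** A subgroup [H] is a (total) perfect code iff it has an inverse-closed right
    transversal containing (avoiding) the identity; trading the representative
    of [H] itself shows that a total perfect code is a perfect code containing
    an involution.  For normal [H], cosets that are not self-inverse can be
    represented in mutually inverse pairs, so the only obstruction to a perfect
    code is a self-inverse coset [H x], i.e. one with [x ^+ 2] in [H], that
    contains no [y] with [y ^+ 2 = 1].  In the dihedral group every element
    outside [<[a]>] squares to [1].  Hence if [H] is not inside [<[a]>], every
    coset of [H] contains such a [y]; otherwise [H] is normal, only cosets
    inside the cyclic group [<[a]>] matter, and there subgroups are determined
    by their orders. *)
Require Import Defs.
From mathcomp Require Import all_boot all_fingroup all_solvable.
Set Implicit Arguments.
Unset Strict Implicit.
Unset Printing Implicit Defensive.
Local Open Scope group_scope.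

(** * Perfect codes as inverse-closed transversals *)

Section Transversals.
Variables (gT : finGroupType) (H : {group gT}).
Implicit Types (S T : {set gT}) (x y t u : gT).

Definition right_transversal T : Prop :=
  forall x, exists! t, t \in T /\ t \in H :* x.

(** The map sending [c] to [c * v^-1] is a bijection from the neighbours of [v] in [H] onto the
    elements of [S] in [H :* v^-1]. *)
Lemma total_perfect_code_in_CayE S :
  total_perfect_code_in (Cay S) H <-> right_transversal S.
Proof.
split=> codeS x.
  have [c [[Hc Sc] uc]] := codeS x^-1; exists (c * x); split.
    by rewrite mem_rcoset mulgK; move: Sc; rewrite /Cay /= invgK.
  move=> t [St]; rewrite mem_rcoset => Htx.
  by rewrite (uc (t * x^-1)) ?mulgKV // /Cay /= invgK mulgKV.
have [t [[St]]] := codeS x^-1; rewrite mem_rcoset invgK => Ht ut.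
exists (t * x); split=> [|c [Hc Sc]]; first by rewrite /Cay /= mulgK.
by rewrite (ut (c * x^-1)) ?mulgKV // mem_rcoset invgK mulgKV.
Qed.

(** Adjoining [1] to [S] puts a loop at every vertex, which turns distance at most one into
    adjacency. *)
Lemma perfect_code_in_CayE S :
  perfect_code_in (Cay S) H <-> right_transversal (1 |: S).
Proof.
apply: iff_trans (total_perfect_code_in_CayE _).
have eqd v c : dist_le (Cay S) 1 v c <-> Cay (1 |: S) v c.
  apply: iff_trans (dist_le1 _ _ _) _; rewrite /Cay /= !inE -eq_mulgV1; split=> [[->|->]|/orP[/eqP->|]].
  - by rewrite eqxx.
  - exact: orbT.
  - by left.
  by right.
by split=> codeS v; have [c [[Hc /eqd Dc] uc]] := codeS v; exists c; split=> //;
  move=> c' [Hc' /eqd Dc']; apply: uc.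
Qed.

Lemma right_transversal_exchange T t u :
    right_transversal T -> t \in T -> u \in H :* t ->
  right_transversal (u |: T :\ t).
Proof.
move=> trT Tt Htu x; have [s [[Ts Hxs] us]] := trT x.
have [Hxt | H'xt] := boolP (t \in H :* x).
  have Est : s = t by apply: us.
  exists u; split.
    by rewrite !inE eqxx; split=> //; rewrite -(rcoset_eqP Hxt).
  move=> v [/setU1P[-> // | /setD1P[v't Tv]] Hxv].
  by case/eqP: v't; rewrite -Est; apply/esym/us.
exists s; split.
  rewrite !inE Ts andbT; split=> //; apply/orP; right.
  by apply: contraNneq H'xt => <-.
move=> v [/setU1P[-> | /setD1P[_ Tv]] Hxv]; last exact: us.
by case/negP: H'xt; rewrite -(rcoset_eqP Hxv) rcoset_sym.
Qed.

Lemma perfect_codeP :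
  perfect_code H <->
    exists T, [/\ 1 \in T, T^-1 = T & right_transversal T].
Proof.
split=> [[S [S1 SV] /perfect_code_in_CayE trS] | [T [T1 TV trT]]].
  exists (1 |: S); split; rewrite ?setU11 //.
  by apply/setP=> x; rewrite !inE invg_eq1 -mem_invg SV.
exists (T :\ 1); last by apply/perfect_code_in_CayE; rewrite setD1K.
split; first by rewrite setD11.
by apply/setP=> x; rewrite !inE invg_eq1 -mem_invg TV.
Qed.

Lemma total_perfect_code_iff_involution :
  total_perfect_code H <->
    perfect_code H /\ exists2 h, h \in H & h ^+ 2 = 1 /\ h <> 1.
Proof.
split=> [[S [S1 SV] /total_perfect_code_in_CayE trS] | []].
  have [h [[Sh]]] := trS 1; rewrite mulg1 => Hh uh.
  (* Both [h] and [h^-1] represent the coset [H] in [S], so uniqueness identifies them. *)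
  have hV : h^-1 = h.
    by apply/esym/uh; rewrite groupV -mem_invg SV.
  split; last first.
    exists h => //; split; first by rewrite expgS expg1 -{1}hV mulVg.
    by move=> h1; rewrite -h1 Sh in S1.
  apply/perfect_codeP; exists (1 |: S :\ h); rewrite setU11.
  split=> //; last first.
    by apply: right_transversal_exchange => //; rewrite rcoset_id ?group1.
  by apply/setP=> x; rewrite !inE invg_eq1 -{1}hV (inj_eq invg_inj) -mem_invg SV.
case/perfect_codeP=> T [T1 TV trT] [h Hh [h2 h1]].
have hV : h^-1 = h by apply: (mulgI h); rewrite mulgV -h2 expgS expg1.
exists (h |: T :\ 1).
  split; first by rewrite !inE eqxx /= orbF eq_sym; apply/eqP.
  by apply/setP=> x; rewrite !inE invg_eq1 -{1}hV (inj_eq invg_inj) -mem_invg TV.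
by apply/total_perfect_code_in_CayE/right_transversal_exchange; rewrite ?mulg1.
Qed.

(** Since [f] acts on cosets as sets, its choice cannot depend on the element naming the coset; the
    last hypothesis makes its image inverse-closed. *)
Lemma perfect_code_from_representatives (f : {set gT} -> gT) :
    f H = 1 -> (forall x, f (H :* x) \in H :* x) ->
    (forall x, exists y, (f (H :* x))^-1 = f (H :* y)) ->
  perfect_code H.
Proof.
move=> f1 fP fV; apply/perfect_codeP; exists [set f (H :* x) | x : gT].
split.
- by apply/imsetP; exists 1; rewrite ?mulg1.
- apply/setP=> x; rewrite inE; apply/imsetP/imsetP=> [] [y _].
    by move/(canRL invgK)->; case: (fV y) => z ->; exists z.
  by move->; case: (fV y) => z ->; exists z.
move=> x; exists (f (H :* x)); split=> [|t [/imsetP[y _ ->]]].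
  by split=> //; apply: imset_f.
by move=> /rcoset_eqP <-; rewrite (rcoset_eqP (fP y)).
Qed.

Lemma perfect_code_of_square_roots :
  (forall x, exists2 y, y \in H :* x & y ^+ 2 = 1) -> perfect_code H.
Proof.
move=> sqP.
(* The coset [H] is forced to [1]; on other cosets [sqP] ensures that the default [1] is never
   reached. *)
pose f (C : {set gT}) :=
  if C == H then 1 else odflt 1 [pick y in C | y ^+ 2 == 1].
have fP x : f (H :* x) \in H :* x /\ f (H :* x) ^+ 2 = 1.
  rewrite /f; case: eqP => [-> | _]; first by rewrite group1 expg1n.
  case: pickP => [y /andP[Hxy /eqP y2] // | no_y].
  by have [y Hxy /eqP y2] := sqP x; case/andP: (no_y y).
apply: (@perfect_code_from_representatives f) => [|x|x].
- by rewrite /f eqxx.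
- by case: (fP x).
exists x; case: (fP x) => _; rewrite expgS expg1 => f2.
by apply: (mulgI (f (H :* x))); rewrite mulgV f2.
Qed.

Lemma normal_perfect_codeP :
    H <| [set: gT] ->
  perfect_code H <->
    (forall x, x ^+ 2 \in H -> exists2 y, y \in H :* x & y ^+ 2 = 1).
Proof.
move=> nHG; have nH x : x \in 'N(H) by apply: (subsetP (normal_norm nHG)).
have HxV x : (H :* x)^-1 = H :* x^-1.
  by rewrite invg_rcoset norm_rlcoset ?groupV.
split=> [/perfect_codeP[T [_ TV trT]] x Hx2 | sqP].
  have [t [[Tt Hxt] ut]] := trT x; exists t => //.
  (* As [x ^+ 2] is in [H], the coset of [x] is self-inverse, so [t^-1] also represents it in
     [T]. *)
  suff tV : t = t^-1 by rewrite expgS expg1 {1}tV mulVg.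
  apply: ut; rewrite -mem_invg TV; split=> //.
  rewrite -mem_invg HxV; suff <- : H :* x = H :* x^-1 by [].
  by apply/rcoset_eqP; rewrite mem_rcoset invgK.
(* In a pair of distinct mutually inverse cosets, the one of smaller [enum_rank] takes its [repr]
   and the other takes the inverse of that element. *)
pose f (C : {set gT}) :=
  if C == H then 1
  else if C == C^-1 then odflt 1 [pick y in C | y ^+ 2 == 1]
  else if enum_rank C < enum_rank C^-1 then repr C else (repr C^-1)^-1.
have fP x : f (H :* x) \in H :* x.
  rewrite /f; case: eqP => [-> // | _].
  case: eqP => [HV | _]; last first.
    case: ifP => _; first exact: mem_repr_rcoset.
    by rewrite -mem_invg HxV mem_repr_rcoset.
  case: pickP => [y /andP[] // | no_y].
  have [|y Hxy /eqP y2] := sqP x; last by case/andP: (no_y y).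
  have: x \in H :* x^-1 by rewrite -HxV -HV rcoset_refl.
  by rewrite mem_rcoset invgK.
apply: (@perfect_code_from_representatives f) => // [|x].
  by rewrite /f eqxx.
have HxVV : (H :* x)^-1^-1 = H :* x by apply/setP=> y; rewrite !inE invgK.
have eqHV : ((H :* x)^-1 == H) = (H :* x == H).
  by apply/eqP/eqP=> [E | ->]; rewrite ?invGid // -HxVV E invGid.
exists x^-1; rewrite -HxV /f HxVV eqHV.
case: eqP => [_ | HxH]; first exact: invg1.
rewrite [_ == H :* x]eq_sym; case: eqP => [<- | /eqP HV].
  case: pickP => [y /andP[_ /eqP] | _ ]; last exact: invg1.
  by rewrite expgS expg1 => y2; apply: (mulgI y); rewrite mulgV y2.
case: ltngtP => // [|E]; first by rewrite invgK.
by case/eqP: HV; apply/enum_rank_inj/val_inj.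
Qed.

End Transversals.

(** * Square roots of the identity in cosets within a cyclic group *)

Lemma cyclic_mem_order (gT : finGroupType) (G H : {group gT}) (x : gT) :
    cyclic G -> H \subset G -> x \in G -> (x \in H) = (#[x] %| #|H|).
Proof.
move=> cG sHG Gx.
by rewrite -cycle_subG orderE (cardSg_cyclic cG) ?cycle_subG.
Qed.

Lemma cyclic_square_rootsP (gT : finGroupType) (G H : {group gT}) :
    cyclic G -> H \subset G ->
  (forall x : gT, x \in G -> x ^+ 2 \in H ->
     exists2 y : gT, y \in H :* x & y ^+ 2 = 1)
    <-> odd #|H| \/ odd (#|G| %/ #|H|).
Proof.
move=> cG sHG; have mH := cyclic_mem_order cG sHG.
have dvHG := cardSg sHG; have H_gt0 := cardG_gt0 H.
have oG := divnK dvHG; set d := #|G| %/ #|H| in oG *.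
split=> [sqP | odd_md x Gx Hx2].
  apply/orP; rewrite -[_ || _]negbK negb_or; apply/negP=> /andP[ev_m ev_d].
  have [g defG] := cyclicP cG.
  have og : #[g] = (d * #|H|)%N by rewrite oG defG.
  have [c d2] : exists c, d = (c * 2)%N.
    by exists d./2; rewrite muln2 even_halfK.
  have c_gt0 : c > 0.
    by have:= order_gt0 g; rewrite og d2 !muln_gt0 andbT => /andP[].
  (* With [c] half of [d], the square of [g ^+ c] generates [H], but [g ^+ c] has order twice [#|H|]
     and so lies outside [H]. *)
  have Gg : g ^+ c \in G by rewrite defG mem_cycle.
  have o_gc : #[g ^+ c] = (2 * #|H|)%N.
    have -> : (2 * #|H| = #[g] %/ c)%N by rewrite og d2 -mulnA mulKn.
    by rewrite orderXdiv // og d2 -mulnA dvdn_mulr.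
  have [|y Hy y2] := sqP _ Gg.
    rewrite -[_ ^+ 2]expgM -d2 mH ?defG ?mem_cycle // orderXdiv og ?dvdn_mulr // mulKn //.
    by rewrite d2 muln_gt0 c_gt0.
  have Gy : y \in G.
    by move: Hy; rewrite mem_rcoset => /(subsetP sHG); rewrite groupMr ?groupV.
  (* The order of [y] divides 2, hence the even number [#|H|]; this would put the whole coset of [y]
     in [H]. *)
  have yH : y \in H.
    by rewrite mH // (@dvdn_trans 2) ?dvdn2 // order_dvdn y2.
  have : g ^+ c \in H by rewrite -(rcoset_id yH) rcoset_sym.
  by rewrite mH // o_gc => /(dvdn_leq H_gt0); rewrite leqNgt ltn_Pmull.
case: odd_md => [odd_m | odd_d].
  (* For odd [#|H|] this witness is [x ^+ #|H|]. *)
  exists ((x ^+ 2) ^+ #|H|./2 * x).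
    by rewrite mem_rcoset mulgK groupX.
  rewrite -expgM -expgSr.
  have -> : (2 * #|H|./2).+1 = #|H|.
    by rewrite mul2n -[in RHS](odd_double_half #|H|) odd_m.
  by apply/eqP; rewrite -expgM mulnC expgM -order_dvdn order_dvdG.
(* The order of [x] divides [2 * #|H|] and [d * #|H|], hence [#|H|] because [d] is odd; thus [x] is
   in [H]. *)
exists 1; last exact: expg1n.
rewrite rcoset_sym mulg1 mH //.
suff: #[x] %| gcdn (2 * #|H|) (d * #|H|).
  by rewrite -muln_gcdl (eqP (_ : coprime 2 d)) ?mul1n ?coprime2n.
rewrite dvdn_gcd oG order_dvdG // andbT order_dvdn expgM -order_dvdn.
exact: order_dvdG.
Qed.

Lemma sqr_mul_inverted (gT : finGroupType) (x y : gT) :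
  x ^ y = x^-1 -> y ^+ 2 = 1 -> (x * y) ^+ 2 = 1.
Proof. by move=> xy <-; rewrite !(expgS _ 1) !expg1 {1}(conjgC x) xy -mulgA mulKg. Qed.

(** * Rotations and reflections from the dihedral relations *)

Section DihedralRelations.
Variables (gT : finGroupType) (a b : gT).
Hypotheses (genD : <<[set a; b]>> = [set: gT]).
Hypotheses (relB : b ^+ 2 = 1) (relAB : (a * b) ^+ 2 = 1).

Let bV : b^-1 = b.
Proof. by apply: (mulgI b); rewrite mulgV -relB expgS expg1. Qed.

Let conj_ab : a ^ b = a^-1.
Proof.
apply: (mulgI a); rewrite mulgV -relAB expgS expg1 /conjg bV.
by rewrite !mulgA.
Qed.

Let norm_b : <[b]> \subset 'N(<[a]>).
Proof. by rewrite norms_cycle conj_ab groupV cycle_id. Qed.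

Lemma dihedral_mulE : <[a]> * <[b]> = [set: gT].
Proof. by rewrite -norm_joinEr // -genD /cycle joing_idl joing_idr. Qed.

Lemma dihedral_rotations_normal : <[a]> <| [set: gT].
Proof. by rewrite -dihedral_mulE -norm_joinEr // normalYl. Qed.

(** Such an [x] is a power of [a] times [b], and conjugation by [b] inverts powers of [a]. *)
Lemma dihedral_reflection_sqr x : x \notin <[a]> -> x ^+ 2 = 1.
Proof.
have: x \in <[a]> * <[b]> by rewrite dihedral_mulE inE.
case/mulsgP=> r _ Ar /cycleP[j ->] ->.
rewrite -(odd_double_half j) expgD -mul2n expgM relB expg1n mulg1.
case: (odd j); rewrite ?mulg1 ?Ar // expg1 => _.
case/cycleP: Ar => i ->; apply: sqr_mul_inverted => //.
by rewrite conjXg conj_ab expgVn.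
Qed.

(** The relation on [a] only bounds its order above by [n]. Below, the presentation maps the group
    onto ['D_(n.*2)], of order [2n], while the group has at most [2 * #[a]] elements. *)
Lemma dihedral_order_rotation n :
    n >= 2 -> [set: gT] \isog Grp (x : y : x ^+ n, y ^+ 2, (x * y) ^+ 2) ->
  a ^+ n = 1 -> #[a] = n.
Proof.
move=> n_ge2 presD relA; have n_gt0 : n > 0 by apply: ltnW.
apply/eqP; rewrite eqn_leq dvdn_leq ?order_dvdn ?relA //=.
have homD : [set: 'D_(n.*2)] \homg [set: gT].
  rewrite presD.
  have := isoGrp_hom (Grp_dihedral n_ge2).
  case/existsP=> -[x y] /= /eqP[defD xn y2 xy].
  apply/existsP; exists (x, y); rewrite /= !xpair_eqE /= defD xn y2 !eqxx /=.
  by rewrite sqr_mul_inverted.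
rewrite -(leq_pmul2r (isT : 0 < 2)) muln2 -{1}(card_dihedral n_ge2).
rewrite (leq_trans (leq_homg homD)) //= -dihedral_mulE.
have b_le2 : #[b] <= 2 by rewrite dvdn_leq // order_dvdn relB.
rewrite (leq_trans _ (leq_mul (leqnn _) b_le2)) // [X in _ <= X]mul_cardG.
by rewrite leq_pmulr ?cardG_gt0.
Qed.

End DihedralRelations.

Theorem theorem2p11 (n : nat) (gT : finGroupType) (a b : gT) (H : {group gT})
    (n_ge3 : 3 <= n)
    (presD : [set: gT] \isog Grp (x : y : x ^+ n, y ^+ 2, (x * y) ^+ 2))
    (genD : <<[set a; b]>> = [set: gT])
    (relA : a ^+ n = 1) (relB : b ^+ 2 = 1) (relAB : (a * b) ^+ 2 = 1)
    (properH : H \proper [set: gT]) :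
  (perfect_code H <->
     (~ (H \subset <[a]>)
      \/ (H \subset <[a]> /\ (odd #|H| \/ odd (n %/ #|H|)))))
  /\
  (total_perfect_code H <->
     (~ (H \subset <[a]>)
      \/ [/\ H \subset <[a]>, ~~ odd #|H| & odd (n %/ #|H|)])).
Proof.
have oA := dihedral_order_rotation genD relB relAB (ltnW n_ge3) presD relA.
have sqr x := @dihedral_reflection_sqr _ a b genD relB relAB x.
have [sHA | /negP nsHA] := boolP (H \subset <[a]>); last first.
  (* Multiplying a rotation by [h] leaves [<[a]>] without leaving its coset of [H]; [h] itself is
     the involution needed for total codes. *)
  have [h Hh Ah] := subsetPn (introN idP nsHA).
  have pcH : perfect_code H.
    apply: perfect_code_of_square_roots => x.
    have [Ax | A'x] := boolP (x \in <[a]>); last first.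
      by exists x; [apply: rcoset_refl | apply: sqr].
    exists (h * x); first by rewrite mem_rcoset mulgK.
    by apply: sqr; rewrite groupMr.
  split; split=> _; [by left | by [] | by left | ].
  apply/total_perfect_code_iff_involution; split=> //; exists h => //.
  by split; [apply: sqr | move=> h1; rewrite h1 group1 in Ah].
(* Subgroups of the cyclic normal subgroup [<[a]>] are characteristic in it. *)
have nHG : H <| [set: gT].
  apply: char_normal_trans (dihedral_rotations_normal genD relB relAB).
  by rewrite sub_cyclic_char ?cycle_cyclic.
have pcH : perfect_code H <-> odd #|H| \/ odd (n %/ #|H|).
  rewrite -{1}oA.
  apply: iff_trans (cyclic_square_rootsP (cycle_cyclic a) sHA).
  apply: iff_trans (normal_perfect_codeP nHG) _.
  split=> sqP x => [Ax|]; first exact: sqP.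
  have [Ax|/sqr x2 _] := boolP (x \in <[a]>); first exact: sqP.
  by exists x; first exact: rcoset_refl.
split; first by split=> [/pcH|[//|[_]]]; [right | move/pcH].
split=> [/total_perfect_code_iff_involution[/pcH odd_or [h Hh [h2 h1]]] | [//|]].
  have ev_m : ~~ odd #|H|.
    have oh : #[h] = 2 by apply: nt_prime_order => //; apply/eqP.
    by rewrite -dvdn2 -oh order_dvdG.
  right; split=> //.
  by case: odd_or => // odd_m; rewrite odd_m in ev_m.
case=> _ ev_m odd_d; apply/total_perfect_code_iff_involution.
split; first by apply/pcH; right.
have [|h Hh oh] := Cauchy (isT : prime 2) (_ : 2 %| #|H|); first by rewrite dvdn2.
exists h => //; split; first by rewrite -oh expg_order.
by move=> h1; rewrite h1 order1 in oh.
Qed.
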